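(* Let $r\ge 2$ be an integer and $F$ an $r$-graph. For every $n\in\mathbb N$, $$\mathrm{ar}(n,(t+1)F)=\mathrm{ex}(n,tF)+2\quad\text{for}\quad 1\le t\le\sqrt{\frac{\mathrm{ex}(n,F)-\mathrm{ex}(n,\{F\}\cup F\oplus F)}{2v(F)|F|\binom{n-1}{r-1}}}.$$ In particular, if $F$ is edge-sensitive, then for all sufficiently large $n$, $\mathrm{ar}(n,2F)=\mathrm{ex}(n,F)+2$.
   Context: An $r$-graph is a collection of $r$-subsets (edges) of a finite vertex set; $v(F)$ is the number of vertices of $F$, $|F|$ its number of edges, and $K_n^r$ is the complete $r$-graph on $n$ vertices. $tF$ denotes $t$ vertex-disjoint copies of $F$. An edge-colored copy of $tF$ is rainbow if no two of its edges share a color. For $t\le n/v(F)$, $\mathrm{ar}(n,tF)$ is the minimum $N$ such that every surjective edge-coloring $K_n^r\to[N]$ contains a rainbow copy of $tF$. For a family $\mathcal F$ of $r$-graphs, $\mathrm{ex}(n,\mathcal F)$ is the maximum number of edges in an $n$-vertex $r$-graph containing no member of $\mathcal F$ as a subgraph. Edge-sum: for $r$-graphs $F,F'$, edges $e\in F$, $e'\in F'$ and a bijection $\phi:e\to e'$, $F\oplus_\phi F'$ is the $r$-graph obtained from $F\setminus\{e\}$ and $F'\setminus\{e'\}$ (on disjoint vertex sets) by identifying $v$ with $\phi(v)$ for all $v\in e$. $F\oplus F'$ is the family of all such $F\oplus_\phi F'$ over all pairs $(e,e')\in F\times F'$ and bijections $\phi:e\to e'$, and $\{F\}\cup F\oplus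 F$ means $\{F\}\cup(F\oplus F)$. $F$ is edge-sensitive if there is $N_0$ such that $\mathrm{ex}(n,F)-\mathrm{ex}(n,\{F\}\cup F\oplus F)\ge 2v(F)|F|\binom{n-1}{r-1}$ for all $n\ge N_0$. *)

(* Defs.v *)
From HB Require Import structures.
From mathcomp Require Import all_boot all_order all_algebra.
From mathcomp Require Import boolp reals.

Set Implicit Arguments.
Unset Strict Implicit.
Unset Printing Implicit Defensive.

Import Order.TTheory GRing.Theory Num.Theory.

Record hgraph : Type := HGraph {
  vert : finType;
  edges : {set {set vert}}
}.

Definition uniform (r : nat) (F : hgraph) : Prop :=
  forall e, e \in edges F -> #|e| = r.

Definition complete (r n : nat) : hgraph :=
  @HGraph 'I_n [set e : {set 'I_n} | #|e| == r].

(* Vertices not covered by any edge of [F] also have to be embedded. *)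
Definition embedding (F G : hgraph) (f : vert F -> vert G) : Prop :=
  injective f /\ forall e, e \in edges F -> f @: e \in edges G.

Definition contains (G F : hgraph) : Prop :=
  exists f : vert F -> vert G, embedding f.

Definition copies (t : nat) (F : hgraph) : hgraph :=
  @HGraph ('I_t * vert F)%type
    [set [set (i, x) | x in e] | i : 'I_t, e : {set vert F} in edges F].

(* Predicates rather than [set hgraph], which is universe-inconsistent. *)
Definition family : Type := hgraph -> Prop.

Definition single (F : hgraph) : family := fun H => H = F.

Definition family_union (Fs Fs' : family) : family := fun H => Fs H \/ Fs' H.

(* The maximum is 0 when every [r]-graph on [n] vertices contains a member of
   [Fs]. *)
Definition ex (r n : nat) (Fs : family) : nat :=
  \max_(G : {set {set 'I_n}} | (G \subset edges (complete r n)) &&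
      `[< forall F, Fs F -> ~ contains (HGraph G) F >]) #|G|.

(* The vertex [x] of [F] is sent to [phi x] if it lies in [e], and is kept
   otherwise; the vertex set of the edge-sum is [(V(F) \ e) + V(F')]. *)
Definition glue (F F' : hgraph) (e : {set vert F}) (phi : vert F -> vert F')
    (x : vert F) : {y : vert F | y \notin e} + vert F' :=
  if insub x is Some y then inl y else inr (phi x).

Definition edge_sum (F F' : hgraph) (e : {set vert F}) (e' : {set vert F'})
    (phi : vert F -> vert F') : hgraph :=
  @HGraph ({y : vert F | y \notin e} + vert F')%type
    ([set [set glue e phi x | x in f] | f : {set vert F} in edges F :\ e] :|:
     [set [set inr x | x in f] | f : {set vert F'} in edges F' :\ e']).

(* Only the restriction of [phi] to [e] matters; the last two conditions on it
   say that this restriction is a bijection from [e] to [e']. *)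
Definition edge_sums (F F' : hgraph) : family :=
  fun H => exists (e : {set vert F}) (e' : {set vert F'})
      (phi : vert F -> vert F'),
    [/\ e \in edges F, e' \in edges F', {in e &, injective phi},
        phi @: e = e' & H = edge_sum e e' phi].

(* The colors are 0, ..., N - 1; values of [c] outside of the edges of the
   complete [r]-graph are irrelevant. *)
Definition surj_coloring (r n N : nat) (c : {set 'I_n} -> nat) : Prop :=
  (forall e, e \in edges (complete r n) -> c e < N) /\
  (forall k, k < N -> exists2 e, e \in edges (complete r n) & c e = k).

Definition rainbow_copy (r n : nat) (c : {set 'I_n} -> nat) (H : hgraph) : Prop :=
  exists f : vert H -> vert (complete r n),
    embedding f /\ {in edges H &, injective (fun e : {set vert H} => c (f @: e))}.

(* [N] has to be positive: a nonempty [complete r n] has no coloring with the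
   empty set of colors, so [N = 0] would satisfy the condition vacuously. *)
Definition forces_rainbow (r n : nat) (H : hgraph) (N : nat) : Prop :=
  0 < N /\
  forall c : {set 'I_n} -> nat, surj_coloring r N c -> rainbow_copy r c H.

Lemma forces_rainbow_ex (r n : nat) (H : hgraph) :
  exists N, `[< forces_rainbow r n H N >].
Proof.
exists #|edges (complete r n)|.+1; apply/asboolP; split=> // c [_ csurj].
suff: #|edges (complete r n)|.+1 <= #|edges (complete r n)| by rewrite ltnn.
have sub : {subset iota 0 #|edges (complete r n)|.+1
              <= [seq c e | e <- enum (edges (complete r n))]}.
  move=> k; rewrite mem_iota add0n => /csurj[e eK <-].
  by apply: map_f; rewrite mem_enum.
have := uniq_leq_size (iota_uniq _ _) sub.
by rewrite size_iota size_map -cardE.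
Qed.

Definition ar (r n : nat) (H : hgraph) : nat := ex_minn (forces_rainbow_ex r n H).

(* [ex r n] is antitone in the family, so the truncated subtraction is exact. *)
Definition edge_sensitive (r : nat) (F : hgraph) : Prop :=
  exists N0 : nat, forall n, N0 <= n ->
    2 * #|vert F| * #|edges F| * 'C(n.-1, r.-1)
      <= ex r n (single F)
         - ex r n (family_union (single F) (edge_sums F F)).

Lemma uniform_copies r t F : uniform r F -> uniform r (copies t F).
Proof.
move=> uF _ /imset2P[i e _ eF ->].
by rewrite card_imset ?(uF e eF)// => x y [].
Qed.

Lemma uniform_edge_sums r F F' H :
  uniform r F -> uniform r F' -> edge_sums F F' H -> uniform r H.
Proof.
move=> uF uF' [e [e' [phi [_ _ phiI _ ->]]]] g /=; rewrite inE.
case/orP=> /imsetP[f /setD1P[_ fF] ->]; last first.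
  by rewrite card_imset ?(uF' f fF)// => x y [].
rewrite card_imset ?(uF f fF)// => x y; rewrite /glue.
case: insubP => [u _ ux|]; case: insubP => [v _ vy|] //.
- by move=> [uv]; rewrite -ux -vy uv.
- by rewrite !negbK => ye xe [/phiI]; apply.
Qed.

(* Main.v *)
(* Lower bound: give the edges of an extremal [tF]-free graph distinct colors and
   all other edges one further color; a rainbow [(t+1)F] has at most one edge of
   the latter color, so it contains a copy of [tF] in the extremal graph.

   Upper bound: let [G] contain one edge of every color, so that for every edge
   [g] there is a copy [T g] of [tF] in [G] without [g]. Let [U] consist of the
   vertices of one such copy [T0] and of all [T g] with [g] in [T0]. By the bound
   on [t], deleting the at most [t |V(F)| (t |F| + 1)] vertices of [U] from [G]
   leaves a copy of [F], which completes [T0], or an edge-sum. In the latter case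
   the middle edge has the color of some [g] in [G], one of [T0] and [T g] avoids
   [g], and so does one half of the edge-sum; together with the middle edge this
   half completes a rainbow [(t+1)F]. *)
Require Import Defs.
From HB Require Import structures.
From mathcomp Require Import all_boot all_order all_algebra.
From mathcomp Require Import boolp reals.
From mathcomp Require Import zify.

Set Implicit Arguments.
Unset Strict Implicit.
Unset Printing Implicit Defensive.

Import Order.TTheory GRing.Theory Num.Theory.

(** * Extremal numbers *)

Definition avoids (G : hgraph) (Fs : Defs.family) : Prop :=
  forall F, Fs F -> ~ contains G F.

Lemma card_le_ex r n Fs (G : {set {set 'I_n}}) :
  G \subset edges (complete r n) -> avoids (HGraph G) Fs -> #|G| <= ex r n Fs.
Proof.
move=> GK GF; rewrite /ex; apply: leq_bigmax_cond.
by rewrite GK; apply/asboolP.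
Qed.

Lemma ex_lt_contains r n Fs (G : {set {set 'I_n}}) :
  G \subset edges (complete r n) -> ex r n Fs < #|G| ->
  exists2 H, Fs H & contains (HGraph G) H.
Proof.
move=> GK; rewrite ltnNge => /negP exG.
apply: contrapT => noH; apply: exG; apply: card_le_ex => // H FsH GH.
by apply: noH; exists H.
Qed.

(** The hypothesis makes the empty graph a competitor, so the maximum is attained rather than being
    the default 0 of an empty range. *)
Lemma ex_extremal r n Fs : avoids (@HGraph 'I_n set0) Fs ->
  exists G : {set {set 'I_n}}, [/\ G \subset edges (complete r n),
    avoids (HGraph G) Fs & #|G| = ex r n Fs].
Proof.
move=> av0; rewrite /ex.
have P0 : 0 < #|[pred G : {set {set 'I_n}} | (G \subset edges (complete r n)) &&
   `[< forall F, Fs F -> ~ contains (@HGraph 'I_n G) F >]]|.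
  by apply/card_gt0P; exists set0; rewrite inE sub0set; apply/asboolP.
have [G] := eq_bigmax_cond (fun G : {set {set 'I_n}} => #|G|) P0.
by rewrite inE => /andP[GK /asboolP GF] exG; exists G.
Qed.

Lemma ex_leq r n (Fs Fs' : Defs.family) :
  (forall G : {set {set 'I_n}}, avoids (HGraph G) Fs -> avoids (HGraph G) Fs') ->
  ex r n Fs <= ex r n Fs'.
Proof.
move=> FsFs'; apply/bigmax_leqP => G /andP[GK /asboolP GF].
by apply: card_le_ex => //; apply: FsFs'.
Qed.

Lemma ex_family_unionl r n (Fs Fs' : Defs.family) :
  ex r n (family_union Fs Fs') <= ex r n Fs.
Proof. by apply: ex_leq => G GF H HF; apply: GF; left. Qed.

Lemma ex_le_bin r n Fs : ex r n Fs <= 'C(n, r).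
Proof.
apply/bigmax_leqP => G /andP[GK _].
rewrite (leq_trans (subset_leq_card GK))//=.
by rewrite card_draws card_ord.
Qed.

(** * Containment, disjoint copies and complete graphs *)

Lemma contains_trans G H K : contains G H -> contains H K -> contains G K.
Proof.
move=> [f [fI fE]] [g [gI gE]]; exists (f \o g); split.
  exact: inj_comp.
by move=> e /gE /fE /=; rewrite imset_comp.
Qed.

Lemma copies_contains t F : 0 < t -> contains (copies t F) F.
Proof.
case: t => // t _; exists (fun x => (ord0, x)); split=> [x y []//|e eF].
by apply/imset2P; exists ord0 e.
Qed.

Lemma contains_copies1 F : contains F (copies 1 F).
Proof.
exists snd; split=> [[i x] [j y] /= ->|_ /imset2P[i e _ eF ->]].
  by rewrite (ord1 i) (ord1 j).
by rewrite -imset_comp imset_id.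
Qed.

Lemma ex_le_copies r n t F : 0 < t ->
  ex r n (single F) <= ex r n (single (copies t F)).
Proof.
move=> t0; apply: ex_leq => G GF _ -> GtF; apply: (GF F) => //.
exact: contains_trans GtF (copies_contains _ t0).
Qed.

Lemma ex_copies1 r n F : ex r n (single (copies 1 F)) = ex r n (single F).
Proof.
apply/eqP; rewrite eqn_leq ex_le_copies// andbT.
apply: ex_leq => G GF _ -> cG; apply: (GF (copies 1 F)) => //.
exact: contains_trans cG (contains_copies1 F).
Qed.

Lemma card_copies_edges t F : #|edges (copies t F)| <= t * #|edges F|.
Proof.
rewrite -[X in X * _]card_ord -cardsT -cardsX.
apply: leq_trans (leq_imset_card
  (fun p : 'I_t * {set vert F} => [set (p.1, x) | x in p.2]) _).
apply: subset_leq_card; apply/subsetP => _ /imset2P[i e _ eF ->].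
by apply/imsetP; exists (i, e) => //; rewrite !inE.
Qed.

Lemma contains_complete r n F : uniform r F -> #|vert F| <= n ->
  contains (complete r n) F.
Proof.
move=> uF vn; exists (fun x => widen_ord vn (enum_rank x)).
have I : injective (fun x : vert F => widen_ord vn (enum_rank x)).
  by move=> x y /(congr1 val) /= /ord_inj; apply: enum_rank_inj.
by split=> // e /uF er; rewrite inE card_imset ?er.
Qed.

(** * Deleting vertices and embedding outside them *)

(** Removing [x] injects these edges into the [r]-subsets of the other [n.-1] vertices. *)
Lemma card_edges_through r n (x : 'I_n) :
  #|[set e in edges (complete r.+1 n) | x \in e]| <= 'C(n.-1, r).
Proof.
set S := [set e in _ | _].
have I : {in S &, injective (fun e : {set 'I_n} => e :\ x)}.
  move=> e f; rewrite !inE => /andP[_ xe] /andP[_ xf] ef.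
  by rewrite -(setD1K xe) ef setD1K.
rewrite -(card_in_imset I).
have -> : n.-1 = #|[set~ x]| by rewrite cardsC1 card_ord.
rewrite -cards_draws; apply: subset_leq_card.
apply/subsetP => _ /imsetP[e + ->]; rewrite !inE => /andP[/eqP er xe].
have := cardsD1 x e; rewrite xe er add1n => -[<-]; rewrite eqxx andbT.
by apply/subsetP => y; rewrite !inE => /andP[].
Qed.

(** Every lost edge passes through some vertex of [U]; the union bound applies. *)
Lemma card_delete_vertices r n (G : {set {set 'I_n}}) (U : {set 'I_n}) :
  G \subset edges (complete r.+1 n) ->
  #|G| <= #|[set e in G | [disjoint e & U]]| + #|U| * 'C(n.-1, r).
Proof.
move=> /subsetP GK; rewrite -(cardsID [set e : {set 'I_n} | [disjoint e & U]] G).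
rewrite (_ : G :&: _ = [set e in G | [disjoint e & U]]); last first.
  by apply/setP => e; rewrite !inE.
rewrite leq_add2l -sum_nat_const.
apply: (@leq_trans
  #|\bigcup_(x in U) [set e in edges (complete r.+1 n) | x \in e]|).
  apply: subset_leq_card; apply/subsetP => e; rewrite 2!inE => /andP[eU eG].
  move: eU; rewrite disjoint_subset => /subsetPn[x xe].
  rewrite negbK => xU; apply/bigcupP; exists x => //.
  by rewrite inE GK.
elim/big_ind2 : _ => [|A m B k Am Bk|x _]; first by rewrite cards0.
  by rewrite (leq_trans (leq_card_setU _ _))// leq_add.
exact: card_edges_through.
Qed.

Lemma extend_injection (T V : finType) (A : {set V}) (U : {set T}) (h : V -> T) :
  {in A &, injective h} -> [disjoint h @: A & U] -> #|U| + #|V| <= #|T| ->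
  exists h' : V -> T,
    [/\ injective h', {in A, h' =1 h} & forall x, h' x \notin U].
Proof.
move=> hI hAU UVT; pose B := ~: (h @: A :|: U).
have cB : #|~: A| <= #|B|.
  have := cardsC (h @: A :|: U); have := cardsC A.
  have := (leq_card_setU (h @: A) U).1; rewrite (card_in_imset hI) /B; lia.
(* [b] matches the complement of [A] with free vertices by position in the enumerations; by [cB] the
   default [h x] is never returned. *)
pose b x := nth (h x) (enum B) (index x (enum (~: A))).
have bB x : x \notin A -> b x \in B.
  move=> xA; rewrite -mem_enum mem_nth// -cardE (leq_trans _ cB)//.
  by rewrite cardE index_mem mem_enum inE.
exists (fun x => if x \in A then h x else b x); split.
- have hb x y : x \in A -> y \notin A -> h x <> b y.
    move=> xA /bB + hby; rewrite -hby !inE negb_or => /andP[/negP[]].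
    exact: imset_f.
  move=> x y; case: ifPn => xA; case: ifPn => yA.
  + exact: hI.
  + by move/hb => /(_ xA yA).
  + by move/esym/hb => /(_ yA xA).
  + have ix z : z \notin A -> index z (enum (~: A)) < size (enum B).
      move=> zA; rewrite -cardE (leq_trans _ cB)//.
      by rewrite cardE index_mem mem_enum inE.
    rewrite /b (set_nth_default (h x) (h y)) ?ix// => /eqP.
    rewrite nth_uniq ?ix ?enum_uniq// => /eqP.
    by apply: (index_inj x); rewrite mem_enum inE.
- by move=> x ->.
- move=> x; case: ifPn => [xA|/bB].
    by move: hAU => /disjointFr ->//; apply: imset_f.
  by rewrite !inE negb_or => /andP[].
Qed.

(* The vertices of [D] lying on no edge may be embedded into [U]; there is room
   to move them away. *)
Lemma embedding_outside n (G : {set {set 'I_n}}) (U : {set 'I_n}) (D : hgraph) :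
  contains (HGraph [set e in G | [disjoint e & U]]) D -> #|U| + #|vert D| <= n ->
  exists2 h : vert D -> 'I_n, @embedding D (HGraph G) h
    & forall x, h x \notin U.
Proof.
move=> [h [hI hE]] Un; pose A := \bigcup_(e in edges D) e.
have [|||h' [h'I h'h h'U]] := @extend_injection _ _ A U h _ _ _.
- by move=> x y _ _; apply: hI.
- rewrite disjoint_subset; apply/subsetP => _ /imsetP[x /bigcupP[e eD xe] ->].
  have := hE e eD; rewrite inE => /andP[_ /disjointFr eU].
  by rewrite inE/= eU//; apply: imset_f.
- by rewrite card_ord.
exists h' => //; split=> // e eD.
rewrite (_ : h' @: e = h @: e); first by have := hE e eD; rewrite inE => /andP[].
apply: eq_in_imset => x xe; apply: h'h; by apply/bigcupP; exists e.
Qed.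

(** * Assembling rainbow copies *)

Lemma embedding_copiesS n (S : {set {set 'I_n}}) t F
    (f : vert (copies t F) -> 'I_n) (h : vert F -> 'I_n) :
  @embedding (copies t F) (HGraph S) f -> @embedding F (HGraph S) h ->
  (forall x y, h x != f y) -> contains (HGraph S) (copies t.+1 F).
Proof.
move=> [fI fE] [hI hE] hf.
(* The new copy [h] takes index 0; the copies of [f] are shifted by one. *)
pose k (p : 'I_t.+1 * vert F) : 'I_n :=
  if unlift ord0 p.1 is Some j then f (j, p.2) else h p.2.
exists k; split=> [[i x] [j y]|_ /imset2P[i e _ eF ->]]; rewrite /k/=.
  case: unliftP => [i' ->|->]; case: unliftP => [j' ->|->].
  - by move/fI => [-> ->].
  - by move/esym/eqP; rewrite (negbTE (hf _ _)).
  - by move/eqP; rewrite (negbTE (hf _ _)).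
  - by move/hI => ->.
rewrite -imset_comp /=; case: (unliftP ord0 i) => [j ->|->].
  rewrite (_ : _ @: e = f @: [set (j, x) | x in e]).
    by apply: fE; apply/imset2P; exists j e.
  by rewrite -imset_comp; apply: eq_imset => x /=; rewrite liftK.
rewrite (_ : _ @: e = h @: e); first exact: hE.
by apply: eq_imset => x /=; rewrite unlift_none.
Qed.

Lemma rainbow_of_injective r n (c : {set 'I_n} -> nat) (S : {set {set 'I_n}}) H :
  S \subset edges (complete r n) -> {in S &, injective c} ->
  contains (HGraph S) H -> rainbow_copy r c H.
Proof.
move=> /subsetP SK cI [f [fI fE]]; exists f; split; first by split=> // e /fE/SK.
move=> a b aH bH /= /cI cab; apply: (imset_inj fI).
by apply: cab; apply: fE.
Qed.

(** * Edge-sums *)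

Lemma glue_in (F F' : hgraph) (e : {set vert F}) (phi : vert F -> vert F') x :
  x \in e -> glue e phi x = inr (phi x).
Proof. by rewrite /glue; case: insubP => // y; case: (x \in e). Qed.

Lemma glue_inr (F F' : hgraph) (e : {set vert F}) (phi : vert F -> vert F') x y :
  glue e phi x = inr y -> x \in e.
Proof. by rewrite /glue; case: insubP => //; rewrite negbK. Qed.

Lemma glue_inj (F F' : hgraph) (e : {set vert F}) (phi : vert F -> vert F') :
  {in e &, injective phi} -> injective (glue e phi).
Proof.
move=> phiI x y; rewrite /glue.
case: insubP => [u _ ux|]; case: insubP => [v _ vy|] //.
- by move=> [uv]; rewrite -ux -vy uv.
- by rewrite !negbK => ye xe [/phiI]; apply.
Qed.

(* [E] is the image of the two identified edges, which is not an edge of the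
   edge-sum. As an edge [g] lies in at most one half, the other half together
   with [E] is a copy of [F] avoiding [g]. *)
Lemma edge_sum_half r n (G : {set {set 'I_n}}) F D
    (h : vert D -> 'I_n) :
  uniform r F -> edge_sums F F D -> @embedding D (HGraph G) h ->
  exists E : {set 'I_n}, #|E| = r /\ forall g, exists2 k : vert F -> 'I_n,
    @embedding F (HGraph (E |: G :\ g)) k & forall x, exists y, k x = h y.
Proof.
move=> uF [e [e' [phi [eF e'F phiI phie De]]]]; subst D => -[hI hE].
have gI := glue_inj phiI.
have iI : injective (fun x : vert F => h (inr x)) by move=> x y /hI [].
pose E := [set h (inr x) | x in e'].
exists E; split; first by rewrite card_imset// (uF e').
move=> g; pose k1 x := h (glue e phi x); pose k2 x := h (inr x).
have k1e : k1 @: e = E.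
  rewrite /E -phie -imset_comp; apply: eq_in_imset => x xe.
  by rewrite /k1/= glue_in.
have k1E f : f \in edges F -> f != e -> k1 @: f \in G.
  move=> fF fe; rewrite /k1 (imset_comp h); apply: hE.
  by rewrite inE; apply/orP; left; apply: imset_f; rewrite !inE fe.
have k2E f : f \in edges F -> f != e' -> k2 @: f \in G.
  move=> fF fe; rewrite /k2 (imset_comp h); apply: hE.
  by rewrite inE; apply/orP; right; apply: imset_f; rewrite !inE fe.
have [/existsP[f /and3P[fF fe /eqP gf]]|no] :=
    boolP [exists f : {set vert F}, [&& f \in edges F, f != e & g == k1 @: f]].
  exists k2; last by move=> x; exists (inr x).
  split=> // f' f'F; rewrite !inE; have [->|f'e'] := eqVneq f' e'.
    by rewrite eqxx.
  rewrite k2E// andbT; apply/orP; right; apply: contraNneq fe.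
  rewrite gf /k1 /k2 (imset_comp h inr) (imset_comp h (glue e phi)).
  move=> /(imset_inj hI) ff'.
  (* If an edge [f] of the first half were also one of the second, all its vertices would be glued,
     so [f] is contained in [e]; equal sizes then force [f = e]. *)
  rewrite eqEcard (uF _ eF) (uF _ fF) leqnn andbT.
  apply/subsetP => x xf.
  have : glue e phi x \in [set inr y | y in f'] by rewrite ff' imset_f.
  by move=> /imsetP[y _ /glue_inr].
exists k1; last by move=> x; exists (glue e phi x).
split; first by move=> x y /hI/gI.
move=> f fF; rewrite !inE; have [->|fe] := eqVneq f e; first by rewrite k1e eqxx.
rewrite k1E// andbT; apply/orP; right; apply: contra no => /eqP kg.
by apply/existsP; exists f; rewrite fF fe kg/=.
Qed.

(** * The two bounds on the number of colors *)

Lemma color_representatives r n N (c : {set 'I_n} -> nat) :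
  surj_coloring r N c -> exists G : {set {set 'I_n}},
    [/\ G \subset edges (complete r n), #|G| = N, {in G &, injective c}
      & forall e, e \in edges (complete r n) -> exists2 g, g \in G & c e = c g].
Proof.
move=> [cN cS].
have /fin_all_exists2[rep repK crep] (k : 'I_N) :
    exists2 e, e \in edges (complete r n) & c e = k by apply: cS.
exists [set rep k | k : 'I_N]; split.
- by apply/subsetP => _ /imsetP[k _ ->].
- rewrite card_imset ?card_ord// => i j ij.
  by apply: val_inj; rewrite /= -!crep ij.
- move=> _ _ /imsetP[i _ ->] /imsetP[j _ ->]; rewrite !crep => ij.
  by congr rep; apply: val_inj.
- move=> e eK; exists (rep (Ordinal (cN e eK))); first exact: imset_f.
  by rewrite crep.
Qed.

Lemma forces_rainbow_gt_ex r n t F N :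
  0 < r -> uniform r F -> 0 < #|edges F| -> 0 < t -> t * #|vert F| <= n ->
  forces_rainbow r n (copies t.+1 F) N -> ex r n (single (copies t F)) + 2 <= N.
Proof.
move=> r0 uF F0 t0 tvn [N0 force].
have [|G [GK GF exG]] := @ex_extremal r n (single (copies t F)).
  move=> _ -> /(contains_trans)/(_ (copies_contains F t0)) [f [_ fE]].
  by move: F0 => /card_gt0P[e /fE]; rewrite inE.
rewrite -exG addn2 ltnNge; apply/negP => NG.
(* Since [t * #|vert F| <= n], the complete graph contains [tF], hence is not inside [G]. *)
have [e0 e0K e0G] : exists2 e, e \in edges (complete r n) & e \notin G.
  apply/subsetPn/negP => KG; apply: (GF (copies t F)) => //.
  have [|f [fI fE]] := @contains_complete r n (copies t F) (uniform_copies uF).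
    by rewrite card_prod card_ord.
  by exists f; split=> // e /fE/(subsetP KG).
(* Truncating [G] to [N.-1] edges treats every [N] up to [#|G|.+1] at once. Under [index e s] the
   edges of [s] get the colors below [N.-1], and all others share the out-of-range value [N.-1]. *)
pose s := take N.-1 (enum G).
have sG e : e \in s -> e \in G by move=> /mem_take; rewrite mem_enum.
have ss : size s = N.-1 by rewrite size_takel// -cardE; lia.
have us : uniq s by rewrite take_uniq// enum_uniq.
have [|f [[fI fE] fR]] := force (fun e => index e s).
  split=> [e _|k kN]; first by rewrite -(prednK N0) ltnS -ss index_size.
  have [kN1|kN1] := ltnP k N.-1.
    exists (nth e0 s k); last by rewrite index_uniq// ss.
    by apply: (subsetP GK); apply: sG; rewrite mem_nth// ss.
  exists e0 => //; rewrite memNindex ?ss; first lia.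
  by apply: contra e0G => /sG.
(* A rainbow copy has at most one edge outside [s]; [i0] is the copy of [F] containing it, or
   arbitrary if there is none. *)
have [i0 i0P] : exists i0 : 'I_t.+1, forall i e, i != i0 -> e \in edges F ->
    f @: [set (i, x) | x in e] \in s.
  have [[a aE aS]|no] := pselect (exists2 a,
      a \in edges (copies t.+1 F) & f @: a \notin s).
    move: aE aS => /imset2P[i0 e0' _ e0F ->] aS; exists i0 => i e ii0 eF.
    apply: contraT => iS; have := fR _ _ _ _ _.
    move=> /(_ [set (i, x) | x in e] [set (i0, x) | x in e0']).
    rewrite !memNindex// => /(_ _ _ erefl) eqs.
    (* Empty edges would coincide across different copies; [0 < r] excludes this. *)
    have [x xe] : exists x, x \in e.
      by apply/card_gt0P; rewrite (uF _ eF).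
    have : (i, x) \in [set (i0, x) | x in e0'].
      by rewrite -eqs ?imset_f//; apply/imset2P; [exists i e|exists i0 e0'].
    by case/imsetP=> y _ [ii0' _]; rewrite ii0' eqxx in ii0.
  exists ord0 => i e _ eF; apply: contrapT => /negP fS; apply: no.
  by exists [set (i, x) | x in e] => //; apply/imset2P; exists i e.
apply: (GF (copies t F)) => //; exists (fun p => f (lift i0 p.1, p.2)); split.
  move=> [i x] [j y] /fI/eqP; rewrite xpair_eqE.
  by move=> /andP[/eqP/lift_inj /= -> /eqP /= ->].
move=> _ /imset2P[i e _ eF ->]; apply: sG.
have := i0P (lift i0 i) e; rewrite eq_sym neq_lift => /(_ isT eF).
by rewrite -!imset_comp.
Qed.

Lemma forces_rainbow_ex2 r n t F :
  1 < r -> uniform r F -> 0 < #|edges F| -> 0 < t -> 0 < 'C(n.-1, r.-1) ->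
  t ^ 2 * (2 * #|vert F| * #|edges F| * 'C(n.-1, r.-1)) <=
    ex r n (single F) - ex r n (family_union (single F) (edge_sums F F)) ->
  4 * t ^ 2 * #|vert F| * #|edges F| <= n ->
  forces_rainbow r n (copies t.+1 F) (ex r n (single (copies t F)) + 2).
Proof.
move=> r1 uF F0 t0 C0 gap nbig; split=> [|c csurj]; first by rewrite addn2.
have [G [GK cG cI cov]] := color_representatives csurj.
set v := #|vert F| in gap nbig; set m := #|edges F| in gap nbig F0.
(* [G] has two edges more than the extremal number, so one may be deleted. *)
have tF g : exists f : vert (copies t F) -> 'I_n,
    @embedding (copies t F) (HGraph (G :\ g)) f.
  have [||_ -> [f fE]] := @ex_lt_contains r n (single (copies t F)) (G :\ g).
  - exact: subset_trans (subsetDl _ _) GK.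
  - by have := cardsD1 g G; rewrite cG; case: (g \in G); lia.
  - by exists f.
have {tF}[T TE] := choice tF.
have cardT g : #|[set T g x | x in setT]| <= t * v.
  by rewrite (leq_trans (leq_imset_card _ _))// cardsT card_prod card_ord.
(* [T set0] serves as the base copy [T0], and [W] is its set of edges. *)
pose W := [set T set0 @: (a : {set _}) | a in edges (copies t F)].
pose U := [set T set0 x | x in setT] :|: \bigcup_(g in W) [set T g x | x in setT].
have cardW : #|W| <= t * m.
  exact: leq_trans (leq_imset_card _ _) (card_copies_edges _ _).
have cardU : #|U| <= t * v + t * m * (t * v).
  rewrite (leq_trans (leq_card_setU _ _))// leq_add//.
  apply: (@leq_trans (\sum_(g in W) t * v)); last first.
    by rewrite sum_nat_const leq_mul2r cardW orbT.
  elim/big_ind2 : _ => [|A a B b Aa Bb|g _]; [by rewrite cards0| |exact: cardT].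
  by rewrite (leq_trans (leq_card_setU _ _))// leq_add.
have tm : 0 < t * m by rewrite muln_gt0 t0.
have tm1 : t * v <= t * m * (t * v) by rewrite leq_pmull.
have cardU2 : #|U| <= t ^ 2 * (2 * v * m).
  by rewrite (leq_trans cardU)//; move: tm1; nia.
(* [D] will be [F] or an edge-sum, so it has at most [2 * v] vertices; both [#|U|] and [2 * v] are
   at most half of the bound in [nbig]. *)
have room D : #|vert D| <= 2 * v -> #|U| + #|vert D| <= n.
  move=> Dv; have vt : v <= t * m * (t * v).
    by rewrite (leq_trans _ tm1)// leq_pmull.
  apply: leq_trans nbig; apply: leq_trans (leq_add cardU Dv) _.
  by move: tm1 vt; nia.
pose G' := [set e in G | [disjoint e & U]].
(* Deleting [U] costs at most [#|U| * 'C(n.-1, r.-1)] edges, which [gap] absorbs; the extra 2 in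
   [#|G|] makes the inequality strict. *)
have [||D FD GD] := @ex_lt_contains r n
    (family_union (single F) (edge_sums F F)) G'.
- by apply: subset_trans GK; apply/subsetP => e; rewrite inE => /andP[].
- have := ex_le_copies r n F t0.
  have := ex_family_unionl r n (single F) (edge_sums F F).
  have := @card_delete_vertices r.-1 n G U; rewrite (ltn_predK r1) => /(_ GK).
  have := leq_mul cardU2 (leqnn 'C(n.-1, r.-1)).
  move: gap; rewrite cG -/G' !mulnA; move: (_ * 'C(_, _)) (_ * 'C(_, _)) => a b.
  by move: #|G'|; lia.
have [DF|DFF] := FD.
  rewrite (DF : D = F) in GD.
  have [|h hE hU] := embedding_outside GD; first by apply: room; lia.
  apply: (rainbow_of_injective GK cI).
  apply: (@embedding_copiesS n G t F (T set0) h) => //.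
    by have [TI T0E] := TE set0; split=> // e /T0E /setD1P[].
  move=> x y; apply: contraNneq (hU x) => ->.
  by rewrite inE; apply/orP; left; apply: imset_f.
have Dv : #|vert D| <= 2 * v.
  move: DFF => [e [e' [phi [_ _ _ _ ->]]]] /=.
  by rewrite card_sum card_sig mulSn mul1n leq_add2r max_card.
have [|h hE hU] := embedding_outside GD; first exact: room.
have [E [Er half]] := edge_sum_half uF DFF hE.
have EK : E \in edges (complete r n) by rewrite inE Er.
have [g gG Eg] := cov E EK.
have [k kE kh] := half g.
(* [T g] lies in [U] only because [g] is in [W]; otherwise [T0] already misses [g]. *)
have [T' T'E T'U] : exists2 T' : vert (copies t F) -> 'I_n,
    @embedding (copies t F) (HGraph (G :\ g)) T' & forall x, T' x \in U.
  have [gW|gW] := boolP (g \in W).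
    exists (T g) => // x; rewrite inE; apply/orP; right.
    by apply/bigcupP; exists g => //; apply: imset_f.
  exists (T set0); last by move=> x; rewrite inE imset_f.
  have [TI T0E] := TE set0; split=> // e eF; rewrite inE.
  have /setD1P[_ ->] := T0E _ eF; rewrite andbT inE.
  by apply: contra gW => /eqP <-; apply: imset_f.
(* Exchanging [g] for [E], which has the same color, keeps the colors distinct. *)
apply: (@rainbow_of_injective r n c (E |: G :\ g)).
- apply/subsetP => e /setU1P[->//|/setD1P[_]]; exact: (subsetP GK).
- move=> a b /setU1P[->|/setD1P[ag aG]] /setU1P[->|/setD1P[bg bG]] //.
  + by rewrite Eg => /(cI _ _ gG bG) gb; rewrite gb eqxx in bg.
  + by rewrite Eg => /(cI _ _ aG gG) gb; rewrite gb eqxx in ag.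
  + exact: cI.
- apply: (@embedding_copiesS n _ t F T' k) => //.
    by have [T'I T'G] := T'E; split=> // e /T'G eG; apply/setU1P; right.
  move=> x y; have [z ->] := kh x; apply: contraNneq (hU z) => ->.
  exact: T'U.
Qed.

(** * The anti-Ramsey number *)

Lemma ar_copies r n t F :
  1 < r -> uniform r F -> 0 < #|edges F| -> 0 < t -> 0 < 'C(n.-1, r.-1) ->
  t ^ 2 * (2 * #|vert F| * #|edges F| * 'C(n.-1, r.-1)) <=
    ex r n (single F) - ex r n (family_union (single F) (edge_sums F F)) ->
  ar r n (copies t.+1 F) = ex r n (single (copies t F)) + 2.
Proof.
move=> r1 uF F0 t0 C0 gap.
(* The gap is at most ['C(n, r)], and [n * 'C(n.-1, r.-1) = r * 'C(n, r)] with [r >= 2], so the gap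
   hypothesis itself forces [n] to be large. *)
have nbig : 4 * t ^ 2 * #|vert F| * #|edges F| <= n.
  rewrite -(leq_pmul2r C0) mul_bin_diag (ltn_predK r1).
  apply: (@leq_trans (2 * 'C(n, r))); last by rewrite leq_mul2r r1 orbT.
  have := leq_trans gap (leq_subr _ _).
  move=> /leq_trans/(_ (ex_le_bin r n (single F))).
  rewrite -(leq_pmul2l (isT : 0 < 2)); apply: leq_trans.
  by move: (t ^ 2) #|vert F| #|edges F| 'C(_, _) => *; lia.
have tvn : t * #|vert F| <= n.
  apply: leq_trans nbig; rewrite (_ : 4 * _ * _ * _ =
    t * #|vert F| * (4 * t * #|edges F|)); last by lia.
  by rewrite leq_pmulr// !muln_gt0 t0.
rewrite /ar; case: ex_minnP => N /asboolP forceN minN.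
apply/eqP; rewrite eqn_leq; apply/andP; split.
  by apply: minN; apply/asboolP; apply: forces_rainbow_ex2.
by apply: forces_rainbow_gt_ex forceN => //; apply: ltnW.
Qed.

Theorem theorem1p5 (R : realType) (r : nat) (F : hgraph)
    (r_ge2 : 2 <= r) (F_uniform : uniform r F) (F_nonempty : 0 < #|edges F|) :
  (forall n t : nat, 1 <= t ->
    (t%:R <= Num.sqrt
       (((ex r n (single F))%:R
          - (ex r n (family_union (single F) (edge_sums F F)))%:R)
        / (2 * #|vert F| * #|edges F| * 'C(n.-1, r.-1))%:R) :> R)%R ->
    ar r n (copies t.+1 F) = ex r n (single (copies t F)) + 2)
  /\
  (edge_sensitive r F ->
    exists n0 : nat, forall n, n0 <= n ->
      ar r n (copies 2 F) = ex r n (single F) + 2).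
Proof.
split=> [n t t1|[N0 sens]]; last first.
  (* [n >= r] makes the binomial coefficient positive. *)
  exists (maxn N0 r) => n; rewrite geq_max => /andP[N0n rn].
  rewrite -ex_copies1; apply: ar_copies => //; first by rewrite bin_gt0; lia.
  by rewrite exp1n mul1n; apply: sens.
set S := family_union _ _; set d := 2 * _ * _ * _; set q := (_ / _)%R => tq.
(* Square roots of negative reals and quotients by 0 are 0 by convention; [1 <= t] rules out both,
   so [q] and [d] are positive. *)
have q0 : (0 < q)%R.
  by rewrite -sqrtr_gt0; apply: lt_le_trans tq; rewrite ltr0n.
have d0 : 0 < d.
  rewrite lt0n; apply: contraTneq q0 => d0.
  by rewrite /q d0 invr0 mulr0 ltxx.
have : (t%:R ^+ 2 <= q)%R.
  rewrite -(sqr_sqrtr (ltW q0)) ler_sqr// nnegrE ?sqrtr_ge0//.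
rewrite ler_pdivlMr ?ltr0n// => td.
(* This turns the real difference into the truncated one of [ar_copies]. *)
have exS : ex r n S <= ex r n (single F) by apply: ex_family_unionl.
apply: ar_copies => //; first by move: d0; rewrite /d !muln_gt0 => /andP[].
by rewrite -(ler_nat R) natrM natrX natrB.
Qed.
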